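(* Let $L_1=L_1(f,g)$ be the $E_6^{(1)}$ operator defined in the context. For each blow-up coordinate system below, restrict the linear $q$-difference equation $L_1y(z)=0$ to the exceptional line $g_1=0$ (take the coefficientwise limit $g_1\to0$). Then the indicated gauge transform $u(z)$ of $y(z)$ satisfies the variant of the $q$-Heun equation of degree $3$ $$\prod_{i=1}^3(x-h_iq^{1/2})\,u(x/q)+\prod_{i=1}^3(x-l_iq^{-1/2})\,u(qx)+\Bigl\{-(q^{1/2}+q^{-1/2})x^3+(h_1+h_2+h_3+l_1+l_2+l_3)x^2-Ex+(l_1l_2l_3h_1h_2h_3)^{1/2}(h_4^{1/2}+h_4^{-1/2})\Bigr\}u(x)=0$$ with $x=z$ (for an appropriate overall sign of the square-root constant term), with the following parameters and accessory parameter $E$. (1) Point $P_5=(0,\nu_5/\kappa_2)$: $(f,g)=(f_1g_1,\,g_1+\nu_5/\kappa_2)$, with $f_1\neq0$. Let $q^\lambda=q^{1/2}/\nu_1$ and $u(z)=z^\lambda(z/\nu_1;q)_\infty\,y(z)$. Then $h_1=q^{1/2}\nu_2$, $h_2=q^{1/2}\nu_3$, $h_3=q^{1/2}\nu_4$, $h_4=q\nu_5/\nu_6$, $l_1=q^{1/2}\nu_1$, $l_2=q^{1/2}\kappa_1/\nu_7$, $l_3=q^{1/2}\kappa_1/\nu_8$, and $$E=q^{3/2}\Bigl\{\nu_1\nu_2\nu_3\nu_4\Bigl(\frac{\nu_6}{\nu_5}-1\Bigr)\Bigl(\frac1{f_1}+\frac{\nu_5^2}{\kappa_2^2}\Bigr)+\nu_1\nu_2\nu_3\nu_4\frac{\nu_5}{\kappa_2}\Bigl(\frac1{\nu_1}+\frac1{\nu_2}+\frac1{\nu_3}+\frac1{\nu_4}\Bigr)+\frac{\kappa_2}{q\nu_5}\Bigl(\frac{\kappa_1}{\nu_7}+\frac{\kappa_1}{\nu_8}\Bigr)\Bigr\}.$$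 (2) Point $P_7=(\kappa_1/\nu_7,0)$: $(f,g)=(f_1g_1+\kappa_1/\nu_7,\,g_1)$. Let $q^\lambda=q^{3/2}/\nu_1$ and $u(z)=z^\lambda(z/\nu_1;q)_\infty\,y(z)/(z-\kappa_1/\nu_7)$. Then $h_1=q^{1/2}\nu_2$, $h_2=q^{1/2}\nu_3$, $h_3=q^{1/2}\nu_4$, $h_4=\nu_5/\nu_6$, $l_1=q^{1/2}\nu_1$, $l_2=\kappa_1/(q^{1/2}\nu_7)$, $l_3=q^{1/2}\kappa_1/\nu_8$, and $$E=q^{1/2}\Bigl\{\Bigl(f_1+\frac{\kappa_1^2}{\nu_7^2}\Bigr)\Bigl(\frac{\nu_7}{\nu_8}-1\Bigr)+\frac{\kappa_1}{\nu_7}(\nu_1+\nu_2+\nu_3+\nu_4)+\frac{\kappa_1}{\nu_8}\Bigl(\frac{\kappa_2}{\nu_5}+\frac{\kappa_2}{\nu_6}\Bigr)\Bigr\}.$$ (3) Point $P_1=(\nu_1,1/\nu_1)$: $(f,g)=(f_1g_1+\nu_1,\,g_1+1/\nu_1)$, with $f_1+\nu_1^2\ne0$. Let $q^\lambda=q^{1/2}/\nu_1$ and $u(z)=z^\lambda(z/\nu_1;q)_\infty\,y(z)$. Then $h_1=q^{1/2}\nu_2$, $h_2=q^{1/2}\nu_3$, $h_3=q^{1/2}\nu_4$, $h_4=\nu_5/\nu_6$, $l_1=q^{3/2}\nu_1$, $l_2=q^{1/2}\kappa_1/\nu_7$, $l_3=q^{1/2}\kappa_1/\nu_8$, and $$E=q^{3/2}\Bigl\{\frac{\nu_1(\nu_2-\nu_1)(\nu_3-\nu_1)(\nu_4-\nu_1)}{f_1+\nu_1^2}+\nu_1\Bigl(\frac{\kappa_1}{\nu_7}+\frac{\kappa_1}{\nu_8}\Bigr)+\nu_2\nu_3\nu_4\Bigl(-\frac1{\nu_1}+\frac1{\nu_2}+\frac1{\nu_3}+\frac1{\nu_4}+\frac{\nu_5}{\kappa_2}+\frac{\nu_6}{\kappa_2}\Bigr)\Bigr\}.$$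 For $P_6=(0,\nu_6/\kappa_2)$ the statement (1) holds with $\nu_5\leftrightarrow\nu_6$ exchanged; for $P_8=(\kappa_1/\nu_8,0)$ the statement (2) holds with $\nu_7\leftrightarrow\nu_8$ exchanged; for $P_i=(\nu_i,1/\nu_i)$, $i=2,3,4$, the statement (3) holds with $\nu_1\leftrightarrow\nu_i$ exchanged.
   Context: $q$ is a complex number with $0<|q|<1$, and $\kappa_1,\kappa_2,\nu_1,\dots,\nu_8$ are non-zero complex parameters with $\kappa_1^2\kappa_2^2=q\,\nu_1\nu_2\cdots\nu_8$. $T_zy(z)=y(qz)$, $T_z^{-1}y(z)=y(z/q)$, $(\alpha x;q)_\infty=\prod_{i\ge0}(1-q^i\alpha x)$, and $z^\lambda$ is a branch satisfying $(q^{\pm1}z)^\lambda=q^{\pm\lambda}z^\lambda$. The operator $L_1$ (one member of the Lax pair of the $q$-Painlevé equation of type $E_6^{(1)}$; $f,g$ are its dependent variables) is $$L_1=\frac{z(g\nu_1-1)(g\nu_2-1)(g\nu_3-1)(g\nu_4-1)}{g(fg-1)(gz-q)}-\frac{(g\kappa_2/\nu_5-1)(g\kappa_2/\nu_6-1)\kappa_1^2}{q\,fg\,\nu_7\nu_8}$$ $$+\frac{(\nu_1-z/q)(\nu_2-z/q)(\nu_3-z/q)(\nu_4-z/q)}{f-z/q}\Bigl\{\frac{g}{1-gz/q}-T_z^{-1}\Bigr\}+\frac{(\kappa_1/\nu_7-z)(\kappa_1/\nu_8-z)}{q(f-z)}\Bigl\{\Bigl(\frac1g-z\Bigr)-T_z\Bigr\}.$$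 The space of initial values of the $q$-Painlevé equation of type $E_6^{(1)}$ is $\mathbb P^1\times\mathbb P^1$ (coordinates $(f,g)$) blown up at the eight points $P_1,\dots,P_8$: $(\nu_i,1/\nu_i)_{i=1,2,3,4}$, $(0,\nu_i/\kappa_2)_{i=5,6}$, $(\kappa_1/\nu_i,0)_{i=7,8}$. Each coordinate system $(f_1,g_1)$ in the claim is a chart of the blow-up at the indicated point, $g_1=0$ being the exceptional curve. Restricting $L_1y(z)=0$ to the line $g_1=0$ means: substitute the given expressions for $f,g$ into $L_1$, write the equation as $a\,y(z/q)+b\,y(z)+c\,y(qz)=0$ with $a,b,c$ rational in $z,f_1,g_1$, and take the limits of $a,b,c$ as $g_1\to0$, keeping $f_1$ as a free parameter. Parameter $E$ is called the accessory parameter. ''Appropriate overall sign'' means: $(l_1l_2l_3h_1h_2h_3)^{1/2}(h_4^{1/2}+h_4^{-1/2})$ is evaluated with mutually inverse values $h_4^{1/2},h_4^{-1/2}$ and one of the two possible overall signs of the whole product. *)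

(* Defs.v *)
From mathcomp Require Import all_boot all_order all_algebra complex ring.
From mathcomp Require Import all_classical all_reals all_analysis.

Set Implicit Arguments.
Unset Strict Implicit.
Unset Printing Implicit Defensive.

Import Order.TTheory GRing.Theory Num.Theory numFieldNormedType.Exports.

Local Open Scope classical_set_scope.
Local Open Scope ring_scope.

(* R[i] receives its topology through the generic numFieldType instance, so
   everything involving limits is stated over K : numFieldType and used at
   K := R[i]. *)

(* The parameters nu_1, ..., nu_8 are nu 1, ..., nu 8; the other values of
   nu : nat -> K are never used. *)
Definition exch (K : Type) (i j : nat) (nu : nat -> K) : nat -> K :=
  fun k => if k == i then nu j else if k == j then nu i else nu k.

Section Operator.
Variables (K : numFieldType) (q k1 k2 : K) (nu : nat -> K).

Definition L1 (f g : K) (y : K -> K) (z : K) : K :=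
  ( z * ((g * nu 1 - 1) * (g * nu 2 - 1) * (g * nu 3 - 1) * (g * nu 4 - 1))
      / (g * (f * g - 1) * (g * z - q))
    - (g * k2 / nu 5 - 1) * (g * k2 / nu 6 - 1) * k1 ^+ 2
      / (q * f * g * nu 7 * nu 8) ) * y z
  + (nu 1 - z / q) * (nu 2 - z / q) * (nu 3 - z / q) * (nu 4 - z / q)
      / (f - z / q) * (g / (1 - g * z / q) * y z - y (z / q))
  + (k1 / nu 7 - z) * (k1 / nu 8 - z) / (q * (f - z))
      * ((g^-1 - z) * y z - y (q * z)).

(* The coefficients of y(z/q), y(z) and y(qz) in L1 y(z); see L1E. *)
Definition L1_down (f g z : K) : K :=
  - ((nu 1 - z / q) * (nu 2 - z / q) * (nu 3 - z / q) * (nu 4 - z / q)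
      / (f - z / q)).

Definition L1_mid (f g z : K) : K :=
  z * ((g * nu 1 - 1) * (g * nu 2 - 1) * (g * nu 3 - 1) * (g * nu 4 - 1))
      / (g * (f * g - 1) * (g * z - q))
  - (g * k2 / nu 5 - 1) * (g * k2 / nu 6 - 1) * k1 ^+ 2
      / (q * f * g * nu 7 * nu 8)
  + (nu 1 - z / q) * (nu 2 - z / q) * (nu 3 - z / q) * (nu 4 - z / q)
      / (f - z / q) * (g / (1 - g * z / q))
  + (k1 / nu 7 - z) * (k1 / nu 8 - z) / (q * (f - z)) * (g^-1 - z).

Definition L1_up (f g z : K) : K :=
  - ((k1 / nu 7 - z) * (k1 / nu 8 - z) / (q * (f - z))).

Lemma L1E (f g : K) (y : K -> K) (z : K) :
  L1 f g y z =
  L1_down f g z * y (z / q) + L1_mid f g z * y z + L1_up f g z * y (q * z).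
Proof.
rewrite /L1 /L1_down /L1_mid /L1_up.
set M := _ / (f - z / q); set W := _ / (q * (f - z)).
by rewrite !mulrBr !mulrDl !mulrA !mulNr; ring.
Qed.

(* Restriction of L1 y(z) = 0 to the curve g1 = 0, for a chart
   (f, g) = (F g1, G g1) with f1 fixed: a z, b z, c z are the limits of the
   three coefficients, at every z of D.  D has to avoid the zeros of z, f - z
   and f - z / q at g1 = 0 (division by 0 gives 0 here). *)
Definition L1_restriction (F G : K -> K) (D : set K) (a b c : K -> K) : Prop :=
  forall z, D z ->
  [/\ L1_down (F g1) (G g1) z @[g1 --> 0^'] --> a z,
      L1_mid (F g1) (G g1) z @[g1 --> 0^'] --> b z
    & L1_up (F g1) (G g1) z @[g1 --> 0^'] --> c z].

End Operator.

(* The infinite product (x; q)_oo. *)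
Definition qpoch (K : numFieldType) (q x : K) : K :=
  limn (fun n => \prod_(i < n) (1 - q ^+ i * x)).

(* w is a value of (l1 l2 l3 h1 h2 h3)^(1/2) (h4^(1/2) + h4^(-1/2)). *)
Definition qHeun3_const (K : numFieldType) (h1 h2 h3 h4 l1 l2 l3 w : K) : Prop :=
  exists s t, [/\ s ^+ 2 = l1 * l2 * l3 * h1 * h2 * h3,
                  t ^+ 2 = h4 & w = s * (t + t^-1)].

(* The variant of the q-Heun equation of degree 3 for u at the point x, with
   r = q^(1/2), accessory parameter E and constant term w. *)
Definition qHeun3 (K : numFieldType) (q r h1 h2 h3 l1 l2 l3 E w : K)
    (u : K -> K) (x : K) : Prop :=
  (x - h1 * r) * (x - h2 * r) * (x - h3 * r) * u (x / q)
  + (x - l1 / r) * (x - l2 / r) * (x - l3 / r) * u (q * x)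
  + (- (r + r^-1) * x ^+ 3 + (h1 + h2 + h3 + l1 + l2 + l3) * x ^+ 2
     - E * x + w) * u x = 0.

Definition cexp (R : realType) (z : R[i]) : R[i] :=
  let x := complex.Re z in let y := complex.Im z in
  Complex (expR x * cos y) (expR x * sin y).

(* p is a branch of z^lam on the non-zero complex numbers such that
   (qz)^lam = q^lam z^lam and (z/q)^lam = q^(-lam) z^lam, where qlam is the
   value of q^lam for some determination of log q. *)
Definition qpower_branch (R : realType) (q lam qlam : R[i]) (p : R[i] -> R[i])
    : Prop :=
  [/\ exists2 lq, cexp lq = q & qlam = cexp (lam * lq),
      forall z, z != 0 -> exists2 lz, cexp lz = z & p z = cexp (lam * lz)
    & forall z, z != 0 -> p (q * z) = qlam * p z /\ p (z / q) = qlam^-1 * p z].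

(* Main.v *)
Require Import Defs.
From mathcomp Require Import all_boot all_order all_algebra complex ring.
From mathcomp Require Import all_classical all_reals all_analysis.

Set Implicit Arguments.
Unset Strict Implicit.
Unset Printing Implicit Defensive.

Import Order.TTheory GRing.Theory Num.Theory numFieldNormedType.Exports.

Local Open Scope classical_set_scope.
Local Open Scope ring_scope.

(* In each chart the coefficients of L1 y are rational functions of g1 whose
   singularity at g1 = 0 is removable, so the restriction is read off once they
   are written in a form continuous at g1 = 0.  The gauge factor multiplies
   u(z/q), u(z), u(qz) by explicit rational functions, by the functional
   equations of z^lambda and of (z/nu_1; q)_oo; after this the q-Heun equation
   is a rational multiple of the restricted equation.  The relation
   k1^2 k2^2 = q nu_1 ... nu_8 makes l1 l2 l3 h1 h2 h3 h4 the square of a rational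
   expression T in r, k1, k2 and the nu_i, and the constant term is
   T + T / h4. *)

(** * Functional equation of the infinite product *)

(* No convergence is needed: a divergent limit is [point = 0] on both sides. *)
Lemma qpoch_rec (K : numFieldType) (q x : K) :
  qpoch q x = (1 - x) * qpoch q (q * x).
Proof.
rewrite /qpoch.
set u := fun n => \prod_(i < n) (1 - q ^+ i * x).
set v := fun n => \prod_(i < n) (1 - q ^+ i * (q * x)).
have uS n : u n.+1 = (1 - x) * v n.
  rewrite /u /v big_ord_recl expr0 mul1r; congr (_ * _).
  by apply: eq_bigr => i _; rewrite mulrA -exprSr.
have lim_u : cvgn v -> limn u = (1 - x) * limn v.
  move=> cv; apply: cvg_lim => //; rewrite -cvg_shiftS /=.
  by under eq_fun do rewrite uS; apply: cvgM => //; exact: cvg_cst.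
(* If [1 - x = 0], the products [u n] vanish from [n = 1] on, so [u] converges to 0 whatever [v]
   does. Otherwise [u] and [v] converge or diverge together. *)
have [x1|x1] := eqVneq (1 - x) 0.
  rewrite x1 mul0r; apply: cvg_lim => //; rewrite -cvg_shiftS /=.
  by under eq_fun do rewrite uS x1 mul0r; exact: cvg_cst.
have [/lim_u //|dv] := pselect (cvgn v).
rewrite (dvgP dv) dvgP; first by rewrite mulr0.
move=> /cvgP cu; apply: dv; apply/cvg_ex; exists ((1 - x)^-1 * limn u).
have -> : v = fun n => (1 - x)^-1 * u n.+1.
  by apply/funext => n; rewrite uS mulKf.
apply: cvgM; first exact: cvg_cst.
by rewrite (cvg_shiftS u).
Qed.

(** * Limits of rational expressions at a punctured point *)

Lemma cvg_dnbhs_id (K : numFieldType) (p : K) : x @[x --> p^'] --> p.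
Proof. by move=> A; exact: nbhs_dnbhs. Qed.

(* [cvgD] and its companions are about [f + g], etc.; unifying these with a large
   [fun x => _] is slow and unfolds the ring operations. *)
Section CvgPointwise.
Variables (K : numFieldType) (T : Type) (F : set_system T) (FF : Filter F).
Variables (A B : T -> K) (a b : K).
Hypotheses (Aa : A x @[x --> F] --> a) (Bb : B x @[x --> F] --> b).

Lemma cvg_add_pt : (A x + B x) @[x --> F] --> a + b.
Proof. exact: cvgD. Qed.

Lemma cvg_opp_pt : (- A x) @[x --> F] --> - a.
Proof. exact: cvgN. Qed.

Lemma cvg_mul_pt : (A x * B x) @[x --> F] --> a * b.
Proof. exact: cvgM. Qed.

Lemma cvg_inv_pt : a != 0 -> (A x)^-1 @[x --> F] --> a^-1.
Proof. by move=> a0; exact: cvgV. Qed.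

Lemma cvg_exp_pt (n : nat) : A x ^+ n @[x --> F] --> a ^+ n.
Proof.
elim: n => [|n ih]; first exact: cvg_cst.
by rewrite exprS; under eq_fun do rewrite exprS; exact: cvgM.
Qed.

End CvgPointwise.

(** Descends through the expression, with subterms free of the variable as leaves. Each inverse
    leaves the nonvanishing of the limit of its argument as a side goal. *)
Ltac cvg0 := repeat lazymatch goal with
  | |- cvg_to (nbhs (fmap (fun x => x) _)) _ => exact: cvg_dnbhs_id
  | |- cvg_to (nbhs (fmap (fun _ => ?c) _)) _ => exact: cvg_cst
  | |- cvg_to (nbhs (fmap (fun x => Algebra.add _ _) _)) _ => apply: cvg_add_pt
  | |- cvg_to (nbhs (fmap (fun x => Algebra.opp _) _)) _ => apply: cvg_opp_pt
  | |- cvg_to (nbhs (fmap (fun x => GRing.mul _ _) _)) _ => apply: cvg_mul_pt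
  | |- cvg_to (nbhs (fmap (fun x => GRing.inv _) _)) _ => apply: cvg_inv_pt
  | |- cvg_to (nbhs (fmap (fun x => GRing.exp _ _) _)) _ => apply: cvg_exp_pt
  end.

(** The slope is nonzero, so there is only one zero: if it is 0, the punctured neighbourhood
    excludes it, and otherwise continuity does. Applied to [g * z - q], this allows
    [z = q * k2 / nu 5] at $P_5$, where that expression tends to 0. *)
Lemma near0_affine_neq0 (K : numFieldType) (b c d : K) : c != 0 ->
  \forall x \near (0 : K)^', (x + b) * c - d != 0.
Proof.
move=> c0; have [bc|bc] := eqVneq (b * c - d) 0.
  near=> x; rewrite mulrDl -addrA bc addr0 mulf_neq0 //.
  by near: x; exact: nbhs_dnbhs_neq.
apply: (@cvgr_neq0 _ _ _ _ _ _ ((0 + b) * c - d)); first by cvg0.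
by rewrite add0r.
Unshelve. all: by end_near. Qed.

(** * Removable singularities of the middle coefficient *)

(* Minus the divided difference of (n1 - x)(n2 - x)(n3 - x)(n4 - x) at [s]
   and [w]. *)
Definition quartic_quot (K : fieldType) (n1 n2 n3 n4 s w : K) : K :=
  (n2 - w) * (n3 - w) * (n4 - w) + (n1 - s) * (n3 - w) * (n4 - w)
  + (n1 - s) * (n2 - s) * (n4 - w) + (n1 - s) * (n2 - s) * (n3 - s).

(* The pole at [z = q / g] is apparent, [w] being [z / q]. *)
Lemma apparent_pole (K : fieldType) (q n1 n2 n3 n4 f g w : K) :
  q != 0 -> g != 0 -> f * g - 1 != 0 -> g * w - 1 != 0 -> f - w != 0 ->
  q * w * ((g * n1 - 1) * (g * n2 - 1) * (g * n3 - 1) * (g * n4 - 1))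
      / (g * (f * g - 1) * (g * (q * w) - q))
  + (n1 - w) * (n2 - w) * (n3 - w) * (n4 - w) / (f - w) * (g / (1 - g * w))
  = ((g * n1 - 1) * (g * n2 - 1) * (g * n3 - 1) * (g * n4 - 1)
       * (f * g - 1 - g * w) / (g ^+ 3 * (f * g - 1))
     + quartic_quot n1 n2 n3 n4 g^-1 w) / (f - w).
Proof.
move=> q0 g0 fg gw fw; rewrite /quartic_quot.
have gw' : 1 - g * w != 0 by rewrite -opprB oppr_eq0.
have gq : g * (q * w) - q != 0.
  by rewrite mulrCA -{2}[q]mulr1 -mulrBr mulf_neq0.
by field; rewrite ?q0 ?g0 ?fg ?gw ?fw ?gw' ?gq.
Qed.

(* [mid_P5], [mid_P7] and [mid_P1] are [L1_mid] in the three charts, rewritten so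
   that it is continuous at [g1 = 0]. *)
Definition mid_P5 (K : numFieldType) (q k1 k2 : K) (nu : nat -> K)
    (f1 z g1 : K) : K :=
  let f := f1 * g1 in let g := g1 + nu 5%N / k2 in
  ((g * nu 1%N - 1) * (g * nu 2%N - 1) * (g * nu 3%N - 1) * (g * nu 4%N - 1)
     * (f * g - 1 - g * (z / q)) / (g ^+ 3 * (f * g - 1))
   + quartic_quot (nu 1%N) (nu 2%N) (nu 3%N) (nu 4%N) g^-1 (z / q)) / (f - z / q)
  - k2 / nu 5%N * (g * k2 / nu 6%N - 1) * k1 ^+ 2 / (q * f1 * g * nu 7%N * nu 8%N)
  + (k1 / nu 7%N - z) * (k1 / nu 8%N - z) / (q * (f - z)) * (g^-1 - z).

(** Two summands of [L1_mid] have a pole at [g * z = q], and these poles cancel. The resulting form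
    suits $P_5$ and $P_1$, where [g] has a nonzero limit; its [g ^+ 3] in a denominator makes it
    useless at $P_7$, where [g] tends to 0. *)
Lemma L1_midE (K : numFieldType) (q k1 k2 : K) (nu : nat -> K) (f g z : K) :
  q != 0 -> g != 0 -> f * g - 1 != 0 -> g * z - q != 0 -> f - z / q != 0 ->
  L1_mid q k1 k2 nu f g z =
  ((g * nu 1%N - 1) * (g * nu 2%N - 1) * (g * nu 3%N - 1) * (g * nu 4%N - 1)
     * (f * g - 1 - g * (z / q)) / (g ^+ 3 * (f * g - 1))
   + quartic_quot (nu 1%N) (nu 2%N) (nu 3%N) (nu 4%N) g^-1 (z / q)) / (f - z / q)
  - (g * k2 / nu 5%N - 1) * (g * k2 / nu 6%N - 1) * k1 ^+ 2
      / (q * f * g * nu 7%N * nu 8%N)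
  + (k1 / nu 7%N - z) * (k1 / nu 8%N - z) / (q * (f - z)) * (g^-1 - z).
Proof.
move=> q0 g0 fg gz fw; rewrite /L1_mid.
have zE : z = q * (z / q) by rewrite mulrC divfK.
rewrite -(@apparent_pole _ q) // -?zE; first by rewrite -(mulrA g z); ring.
have -> : g * (z / q) - 1 = (g * z - q) / q by field.
by rewrite mulf_neq0 ?invr_eq0.
Qed.

Lemma near0_P5 (K : numFieldType) (q k1 k2 : K) (nu : nat -> K) (f1 z : K) :
  q != 0 -> z != 0 -> k2 != 0 -> (forall i, (1 <= i <= 8)%N -> nu i != 0) ->
  f1 != 0 ->
  \forall g1 \near 0^',
   mid_P5 q k1 k2 nu f1 z g1 = L1_mid q k1 k2 nu (f1 * g1) (g1 + nu 5%N / k2) z.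
Proof.
move=> q0 z0 k20 nu0 f10; have n5 := nu0 5%N isT.
have b5 : nu 5%N / k2 != 0 by rewrite mulf_neq0 ?invr_eq0.
have zq : z / q != 0 by rewrite mulf_neq0 ?invr_eq0.
near=> g1.
rewrite L1_midE //.
- rewrite /mid_P5; congr (_ - _ + _).
  (* The factor that vanishes at the blown-up point is a multiple of [g1] and cancels the [g1] of
     [f = f1 * g1]. *)
  have -> : (g1 + nu 5%N / k2) * k2 / nu 5%N - 1 = g1 * (k2 / nu 5%N).
    by field; rewrite n5.
  have g10 : g1 != 0 by near: g1; exact: nbhs_dnbhs_neq.
  have gk : g1 * k2 + nu 5%N != 0.
    have -> : g1 * k2 + nu 5%N = (g1 + nu 5%N / k2) * k2 by field.
    apply: mulf_neq0 => //; near: g1.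
    apply: (@cvgr_neq0 _ _ _ _ _ _ (0 + nu 5%N / k2)); first by cvg0.
    by rewrite add0r.
  by field; rewrite g10 k20 gk f10 q0 !nu0.
- near: g1; apply: (@cvgr_neq0 _ _ _ _ _ _ (0 + nu 5%N / k2)); first by cvg0.
  by rewrite add0r.
- near: g1; apply: (@cvgr_neq0 _ _ _ _ _ _ (f1 * 0 * (0 + nu 5%N / k2) - 1)).
    by cvg0.
  by rewrite mulr0 mul0r sub0r oppr_eq0 oner_eq0.
- near: g1; exact: near0_affine_neq0.
- near: g1; apply: (@cvgr_neq0 _ _ _ _ _ _ (f1 * 0 - z / q)); first by cvg0.
  by rewrite mulr0 sub0r oppr_eq0.
Unshelve. all: by end_near. Qed.

Definition mid_P7 (K : numFieldType) (q k1 k2 : K) (nu : nat -> K)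
    (f1 z g : K) : K :=
  let f := f1 * g + k1 / nu 7%N in
  let e1 := nu 1%N + nu 2%N + nu 3%N + nu 4%N in
  let e2 := nu 1%N * nu 2%N + nu 1%N * nu 3%N + nu 1%N * nu 4%N
            + nu 2%N * nu 3%N + nu 2%N * nu 4%N + nu 3%N * nu 4%N in
  let e3 := nu 1%N * nu 2%N * nu 3%N + nu 1%N * nu 2%N * nu 4%N
            + nu 1%N * nu 3%N * nu 4%N + nu 2%N * nu 3%N * nu 4%N in
  let e4 := nu 1%N * nu 2%N * nu 3%N * nu 4%N in
  z * (- q * e1 + z + q * f + g * (q * (e2 - g * e3 + g ^+ 2 * e4) - f * z))
      / (q * ((f * g - 1) * (g * z - q)))
  + (k1 / nu 8%N - z) / q * (- z - f1 * (1 - g * z) / (f - z))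
  + k1 / (q * nu 8%N) * (k2 / nu 5%N + k2 / nu 6%N
      - g * k2 ^+ 2 / (nu 5%N * nu 6%N)
      + f1 / f * (g * k2 / nu 5%N - 1) * (g * k2 / nu 6%N - 1))
  + (nu 1%N - z / q) * (nu 2%N - z / q) * (nu 3%N - z / q) * (nu 4%N - z / q)
      / (f - z / q) * (g / (1 - g * z / q)).

(** At [g = 0] the terms with [g] in the denominator have residues [z / q], [- k1 / (q * nu 8)] and
    [(k1 / nu 8 - z) / q], whose sum is 0. The first three summands of [mid_P7] are what remains of
    these terms once the corresponding multiple of [g^-1] is subtracted from each; the last summand
    is already regular. *)
Lemma mid_P7E (K : numFieldType) (q k1 k2 : K) (nu : nat -> K) (f1 z g : K) :
  let f := f1 * g + k1 / nu 7%N in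
  q != 0 -> k1 != 0 -> (forall i, (1 <= i <= 8)%N -> nu i != 0) ->
  g != 0 -> f != 0 -> f - z != 0 -> f * g - 1 != 0 -> g * z - q != 0 ->
  mid_P7 q k1 k2 nu f1 z g = L1_mid q k1 k2 nu f g z.
Proof.
move=> f q0 k10 nu0 g0; rewrite /mid_P7 /L1_mid {}/f => f0 fz fg gz.
rewrite [RHS]addrAC; congr (_ + _).
have k1E : k1 = (k1 / nu 7%N) * nu 7%N by rewrite divfK ?nu0.
have a70 : k1 / nu 7%N != 0 by rewrite mulf_neq0 ?invr_eq0 ?nu0.
(* With [a7 = k1 / nu 7] as the variable in place of [k1], [f] is polynomial and its nonvanishing
   hypotheses have the form that [field] asks for. *)
move: (k1 / nu 7%N) k1E a70 f0 fz fg gz => a7 -> a70 f0 fz fg gz.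
by field; rewrite g0 fz q0 f0 gz fg !nu0.
Qed.

Lemma near0_P7 (K : numFieldType) (q k1 k2 : K) (nu : nat -> K) (f1 z : K) :
  q != 0 -> k1 != 0 -> (forall i, (1 <= i <= 8)%N -> nu i != 0) ->
  z != k1 / nu 7%N ->
  \forall g1 \near 0^',
   mid_P7 q k1 k2 nu f1 z g1 = L1_mid q k1 k2 nu (f1 * g1 + k1 / nu 7%N) g1 z.
Proof.
move=> q0 k10 nu0 z7.
have a70 : k1 / nu 7%N != 0 by rewrite mulf_neq0 ?invr_eq0 ?nu0.
near=> g1.
have g10 : g1 != 0 by near: g1; exact: nbhs_dnbhs_neq.
have f0 : f1 * g1 + k1 / nu 7%N != 0.
  near: g1; apply: (@cvgr_neq0 _ _ _ _ _ _ (f1 * 0 + k1 / nu 7%N)).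
    by cvg0.
  by rewrite mulr0 add0r.
have fz : f1 * g1 + k1 / nu 7%N - z != 0.
  near: g1; apply: (@cvgr_neq0 _ _ _ _ _ _ (f1 * 0 + k1 / nu 7%N - z)).
    by cvg0.
  by rewrite mulr0 add0r subr_eq0 eq_sym.
have fg : (f1 * g1 + k1 / nu 7%N) * g1 - 1 != 0.
  near: g1.
  apply: (@cvgr_neq0 _ _ _ _ _ _ ((f1 * 0 + k1 / nu 7%N) * 0 - 1)).
    by cvg0.
  by rewrite mulr0 sub0r oppr_eq0 oner_eq0.
have gz : g1 * z - q != 0.
  near: g1; apply: (@cvgr_neq0 _ _ _ _ _ _ (0 * z - q)); first by cvg0.
  by rewrite mul0r sub0r oppr_eq0.
exact: mid_P7E.
Unshelve. all: by end_near. Qed.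

Definition mid_P1 (K : numFieldType) (q k1 k2 : K) (nu : nat -> K)
    (f1 z g1 : K) : K :=
  let f := f1 * g1 + nu 1%N in let g := g1 + (nu 1%N)^-1 in
  let rho := f1 / nu 1%N + nu 1%N + f1 * g1 in
  (nu 1%N * (g * nu 2%N - 1) * (g * nu 3%N - 1) * (g * nu 4%N - 1)
     * (g1 * rho - g * (z / q)) / (g ^+ 3 * rho)
   + quartic_quot (nu 1%N) (nu 2%N) (nu 3%N) (nu 4%N) g^-1 (z / q))
    / (f - z / q)
  - (g * k2 / nu 5%N - 1) * (g * k2 / nu 6%N - 1) * k1 ^+ 2
      / (q * f * g * nu 7%N * nu 8%N)
  + (k1 / nu 7%N - z) * (k1 / nu 8%N - z) / (q * (f - z)) * (g^-1 - z).

(** Both [g * nu 1 - 1] and [f * g - 1] are divisible by [g1], with quotients [nu 1] and [rho]. The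
    condition on [f1] says that [rho] is nonzero at [g1 = 0]: it excludes the point where the
    exceptional line meets the strict transform of the curve [f * g = 1]. *)
Lemma near0_P1 (K : numFieldType) (q k1 k2 : K) (nu : nat -> K) (f1 z : K) :
  q != 0 -> z != 0 -> nu 1%N != 0 -> f1 + nu 1%N ^+ 2 != 0 ->
  z / q != nu 1%N ->
  \forall g1 \near 0^',
   mid_P1 q k1 k2 nu f1 z g1 =
   L1_mid q k1 k2 nu (f1 * g1 + nu 1%N) (g1 + (nu 1%N)^-1) z.
Proof.
move=> q0 z0 n10 f10 zq1.
have rho00 : f1 / nu 1%N + nu 1%N != 0.
  have -> : f1 / nu 1%N + nu 1%N = (f1 + nu 1%N ^+ 2) / nu 1%N by field.
  by rewrite mulf_neq0 ?invr_eq0.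
near=> g1.
have g10 : g1 != 0 by near: g1; exact: nbhs_dnbhs_neq.
have g0 : g1 + (nu 1%N)^-1 != 0.
  near: g1; apply: (@cvgr_neq0 _ _ _ _ _ _ (0 + (nu 1%N)^-1)).
    by cvg0.
  by rewrite add0r invr_eq0.
have rho0 : f1 / nu 1%N + nu 1%N + f1 * g1 != 0.
  near: g1.
  apply: (@cvgr_neq0 _ _ _ _ _ _ (f1 / nu 1%N + nu 1%N + f1 * 0)).
    by cvg0.
  by rewrite mulr0 addr0.
have fgE : (f1 * g1 + nu 1%N) * (g1 + (nu 1%N)^-1) - 1 =
           g1 * (f1 / nu 1%N + nu 1%N + f1 * g1) by field.
rewrite L1_midE // ?fgE ?mulf_neq0 //; last 2 first.
- near: g1; exact: near0_affine_neq0.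
- near: g1; apply: (@cvgr_neq0 _ _ _ _ _ _ (f1 * 0 + nu 1%N - z / q)).
    by cvg0.
  by rewrite mulr0 add0r subr_eq0 eq_sym.
rewrite /mid_P1; congr ((_ + _) / _ - _ + _).
have -> : (g1 + (nu 1%N)^-1) * nu 1%N - 1 = g1 * nu 1%N by field.
set rho := _ + f1 * g1; set g := g1 + _.
by field; rewrite g10 rho0 g0.
Unshelve. all: by end_near. Qed.

(** * Restriction of the operator to the exceptional lines *)

Lemma cvg_of_near (K : numFieldType) (h m : K -> K) (l : K) :
  (\forall x \near 0^', m x = h x) -> m x @[x --> 0^'] --> l ->
  h x @[x --> 0^'] --> l.
Proof. by move=> mh; apply: cvg_trans; apply: near_eq_cvg. Qed.

Ltac near0_simp h := rewrite /= ?(mulr0, mul0r, add0r, sub0r, mulr1, subr0);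
  rewrite ?(mulf_neq0, expf_neq0, invr_eq0, oppr_eq0, oner_eq0, h) //.

(** The outer coefficients depend on [f] alone, so a dummy 0 stands for [g] in them. Writing
    [f1 * 0] unreduced gives the limit the shape that [cvg0] builds. *)
Lemma restriction_P5 (K : numFieldType) (q k1 k2 f1 : K) (nu : nat -> K) :
  q != 0 -> k2 != 0 -> (forall i, (1 <= i <= 8)%N -> nu i != 0) -> f1 != 0 ->
  L1_restriction q k1 k2 nu (fun g1 => f1 * g1) (fun g1 => g1 + nu 5%N / k2)
    [set z | z != 0] (L1_down q nu (f1 * 0) 0)
    (fun z => mid_P5 q k1 k2 nu f1 z 0) (L1_up q k1 nu (f1 * 0) 0).
Proof.
move=> q0 k20 nu0 f10 z /= z0; split.
- by rewrite /L1_down; cvg0; near0_simp nu0.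
- apply: (@cvg_of_near _ _ (mid_P5 q k1 k2 nu f1 z)); first exact: near0_P5.
  by rewrite /mid_P5 /quartic_quot; cvg0; near0_simp nu0.
- by rewrite /L1_up; cvg0; near0_simp nu0.
Qed.

Lemma restriction_P7 (K : numFieldType) (q k1 k2 f1 : K) (nu : nat -> K) :
  q != 0 -> k1 != 0 -> (forall i, (1 <= i <= 8)%N -> nu i != 0) ->
  L1_restriction q k1 k2 nu (fun g1 => f1 * g1 + k1 / nu 7%N) (fun g1 => g1)
    [set z | [&& z != 0, z != k1 / nu 7%N & z / q != k1 / nu 7%N]]
    (L1_down q nu (f1 * 0 + k1 / nu 7%N) 0)
    (fun z => mid_P7 q k1 k2 nu f1 z 0)
    (L1_up q k1 nu (f1 * 0 + k1 / nu 7%N) 0).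
Proof.
move=> q0 k10 nu0 z /= /and3P[z0 z7 zq7].
have fz : k1 / nu 7%N - z != 0 by rewrite subr_eq0 eq_sym.
have fw : k1 / nu 7%N - z / q != 0 by rewrite subr_eq0 eq_sym.
split.
- by rewrite /L1_down; cvg0; near0_simp nu0.
- apply: (@cvg_of_near _ _ (mid_P7 q k1 k2 nu f1 z)); first exact: near0_P7.
  by rewrite /mid_P7; cvg0; near0_simp nu0.
- by rewrite /L1_up; cvg0; near0_simp nu0.
Qed.

Lemma restriction_P1 (K : numFieldType) (q k1 k2 f1 : K) (nu : nat -> K) :
  q != 0 -> (forall i, (1 <= i <= 8)%N -> nu i != 0) ->
  f1 + nu 1%N ^+ 2 != 0 ->
  L1_restriction q k1 k2 nu
    (fun g1 => f1 * g1 + nu 1%N) (fun g1 => g1 + (nu 1%N)^-1)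
    [set z | [&& z != 0, z != nu 1%N & z / q != nu 1%N]]
    (L1_down q nu (f1 * 0 + nu 1%N) 0)
    (fun z => mid_P1 q k1 k2 nu f1 z 0)
    (L1_up q k1 nu (f1 * 0 + nu 1%N) 0).
Proof.
move=> q0 nu0 f10 z /= /and3P[z0 z1 zq1].
have fz : nu 1%N - z != 0 by rewrite subr_eq0 eq_sym.
have fw : nu 1%N - z / q != 0 by rewrite subr_eq0 eq_sym.
have rho0 : f1 / nu 1%N + nu 1%N != 0.
  have -> : f1 / nu 1%N + nu 1%N = (f1 + nu 1%N ^+ 2) / nu 1%N.
    by field; rewrite nu0.
  by rewrite mulf_neq0 ?invr_eq0 ?nu0.
split.
- by rewrite /L1_down; cvg0; near0_simp nu0.
- apply: (@cvg_of_near _ _ (mid_P1 q k1 k2 nu f1 z)).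
    by apply: near0_P1; rewrite ?nu0.
  by rewrite /mid_P1 /quartic_quot; cvg0; near0_simp nu0; rewrite addr0.
- by rewrite /L1_up; cvg0; near0_simp nu0.
Qed.

(** * Gauge transformation and constant term *)

(** The functional equations express the gauge factor at [z / q], [z] and [q * z] through the common
    multiple [p z * qpoch q (q * z / n1)], which then factors out of the whole equation. [M] keeps
    the cubic coefficient of [u] opaque, to be identified separately for each point. *)
Lemma qHeun3_gauge (K : numFieldType) (q r h1 h2 h3 l1 l2 l3 E w n1 ql z M : K)
    (p v : K -> K) :
  q != 0 -> p (q * z) = ql * p z -> p (z / q) = ql^-1 * p z ->
  - (r + r^-1) * z ^+ 3 + (h1 + h2 + h3 + l1 + l2 + l3) * z ^+ 2
     - E * z + w = M ->
  (z - h1 * r) * (z - h2 * r) * (z - h3 * r) / ql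
      * (1 - z / q / n1) * (1 - z / n1) * v (z / q)
  + (z - l1 / r) * (z - l2 / r) * (z - l3 / r) * ql * v (q * z)
  + M * (1 - z / n1) * v z = 0 ->
  qHeun3 q r h1 h2 h3 l1 l2 l3 E w
    (fun x => p x * qpoch q (x / n1) * v x) z.
Proof.
move=> q0 pq pq' ME H; rewrite /qHeun3 {}ME pq pq' (qpoch_rec q (z / q / n1)).
have -> : q * (z / q / n1) = z / n1 by rewrite mulrA [q * _]mulrC divfK.
rewrite (qpoch_rec q (z / n1)) [q * (z / n1)]mulrA.
rewrite -[RHS](mulr0 (p z * qpoch q (q * z / n1))) -{}H.
set A := _ * _ * (z - h3 * r); set C := _ * _ * (z - l3 / r).
ring.
Qed.

(* [T] plays the role of [s * t], which is rational in the parameters. *)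
Lemma qHeun3_const_of_sqr (R : rcfType) (h1 h2 h3 h4 l1 l2 l3 T : R[i]) :
  h4 != 0 -> T ^+ 2 = l1 * l2 * l3 * h1 * h2 * h3 * h4 ->
  qHeun3_const h1 h2 h3 h4 l1 l2 l3 (T + T / h4).
Proof.
move=> h40 T2; set t := sqrtc h4.
have t2 : t ^+ 2 = h4 by exact: sqr_sqrtc.
have t0 : t != 0 by rewrite sqrtc_eq0.
exists (T / t), t; split=> //.
- by rewrite expr_div_n T2 t2 mulfK.
- by rewrite -t2; field.
Qed.

(** * Symmetry under exchange of parameters *)

Lemma exch_neq0 (K : numFieldType) (nu : nat -> K) (i j : nat) :
  (1 <= i <= 8)%N -> (1 <= j <= 8)%N ->
  (forall k, (1 <= k <= 8)%N -> nu k != 0) ->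
  forall k, (1 <= k <= 8)%N -> exch i j nu k != 0.
Proof.
move=> hi hj nu0 k hk; rewrite /exch; case: ifP => _; first exact: nu0.
by case: ifP => _; exact: nu0.
Qed.

(* [L1] is symmetric in the parameters of each block. *)
Definition blocks := [:: [:: 1; 2; 3; 4]; [:: 5; 6]; [:: 7; 8]]%N.

Lemma prod_exch (K : numFieldType) (nu : nat -> K) (B : seq nat) (i j : nat) :
  B \in blocks -> i \in B -> j \in B ->
  \prod_(1 <= k < 9) exch i j nu k = \prod_(1 <= k < 9) nu k.
Proof.
rewrite !inE => /or3P[]/eqP->; rewrite !inE.
- by case/or4P => /eqP-> /or4P[]/eqP->; rewrite unlock /= /exch /=; ring.
- by case/orP => /eqP-> /orP[]/eqP->; rewrite unlock /= /exch /=; ring.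
- by case/orP => /eqP-> /orP[]/eqP->; rewrite unlock /= /exch /=; ring.
Qed.

Lemma L1_mid_exch (K : numFieldType) (q k1 k2 : K) (nu : nat -> K)
    (B : seq nat) (i j : nat) :
  B \in blocks -> i \in B -> j \in B ->
  L1_mid q k1 k2 (exch i j nu) = L1_mid q k1 k2 nu.
Proof.
rewrite !inE => /or3P[]/eqP->; rewrite !inE.
- by case/or4P => /eqP-> /or4P[]/eqP->; apply/funext => f; apply/funext => g;
    apply/funext => z; rewrite /L1_mid /exch /=; ring.
- by case/orP => /eqP-> /orP[]/eqP->; apply/funext => f; apply/funext => g;
    apply/funext => z; rewrite /L1_mid /exch /=; ring.
- by case/orP => /eqP-> /orP[]/eqP->; apply/funext => f; apply/funext => g;
    apply/funext => z;
    (* The exchange reverses two factors inside a denominator; once their order is restored, a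
       polynomial identity in the inverses remains. *)
    rewrite /L1_mid /exch /= ?[_ * nu 8%N * nu 7%N]mulrAC; ring.
Qed.

Lemma L1_down_exch (K : numFieldType) (q : K) (nu : nat -> K)
    (B : seq nat) (i j : nat) :
  B \in blocks -> i \in B -> j \in B ->
  L1_down q (exch i j nu) = L1_down q nu.
Proof.
rewrite !inE => /or3P[]/eqP->; rewrite !inE.
- by case/or4P => /eqP-> /or4P[]/eqP->; apply/funext => f; apply/funext => g;
    apply/funext => z; rewrite /L1_down /exch /=; ring.
- by case/orP => /eqP-> /orP[]/eqP->.
- by case/orP => /eqP-> /orP[]/eqP->.
Qed.

Lemma L1_up_exch (K : numFieldType) (q k1 : K) (nu : nat -> K)
    (B : seq nat) (i j : nat) :
  B \in blocks -> i \in B -> j \in B ->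
  L1_up q k1 (exch i j nu) = L1_up q k1 nu.
Proof.
rewrite !inE => /or3P[]/eqP->; rewrite !inE.
- by case/or4P => /eqP-> /or4P[]/eqP->.
- by case/orP => /eqP-> /orP[]/eqP->.
- by case/orP => /eqP-> /orP[]/eqP->; apply/funext => f; apply/funext => g;
    apply/funext => z; rewrite /L1_up /exch /=; ring.
Qed.

Lemma L1_restriction_exch (K : numFieldType) (q k1 k2 : K) (nu : nat -> K)
    (B : seq nat) (i j : nat) :
  B \in blocks -> i \in B -> j \in B ->
  L1_restriction q k1 k2 (exch i j nu) = L1_restriction q k1 k2 nu.
Proof.
move=> bB iB jB.
by rewrite /L1_restriction (L1_mid_exch _ _ _ _ bB iB jB)
  (L1_down_exch _ _ bB iB jB) (L1_up_exch _ _ _ bB iB jB).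
Qed.

(** * Identification of the cubic coefficient and the constant term *)

Definition acc_P5 (K : numFieldType) (q r k1 k2 : K) (nu : nat -> K) (f1 : K) : K :=
  r ^+ 3 *
    ( nu 1%N * nu 2%N * nu 3%N * nu 4%N * (nu 6%N / nu 5%N - 1)
        * (f1^-1 + nu 5%N ^+ 2 / k2 ^+ 2)
    + nu 1%N * nu 2%N * nu 3%N * nu 4%N * (nu 5%N / k2)
        * ((nu 1%N)^-1 + (nu 2%N)^-1 + (nu 3%N)^-1 + (nu 4%N)^-1)
    + k2 / (q * nu 5%N) * (k1 / nu 7%N + k1 / nu 8%N) ).

(** At [f = 0] both [f - z / q] and [f - z] contribute only a pole at [z = 0], which the multiplier
    clears. Its factor [- (r * q)] normalises the leading coefficient: the restricted one grows like
    [z ^+ 2 * (q^-1 + q ^- 2)]. [T] carries the sign of the square root for which the identity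
    holds. *)
Lemma heun_mid_P5 (K : numFieldType) (q r k1 k2 f1 z : K) (nu : nat -> K) :
  r != 0 -> z != 0 -> k1 != 0 -> k2 != 0 -> f1 != 0 ->
  (forall i, (1 <= i <= 8)%N -> nu i != 0) -> r ^+ 2 = q ->
  k1 ^+ 2 * k2 ^+ 2 = q * \prod_(1 <= i < 9) nu i ->
  let T := r ^+ 3 * k1 ^+ 2 * k2 / (nu 6%N * nu 7%N * nu 8%N) in
  - (r + r^-1) * z ^+ 3
  + (r * nu 2%N + r * nu 3%N + r * nu 4%N + r * nu 1%N + r * k1 / nu 7%N
     + r * k1 / nu 8%N) * z ^+ 2
  - acc_P5 q r k1 k2 nu f1 * z + (T + T / (q * nu 5%N / nu 6%N))
  = - (r * q) * z * mid_P5 q k1 k2 nu f1 z 0.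
Proof.
move=> r0 z0 k10 k20 f10 nu0 <-.
rewrite unlock /= !mulr1 => rel.
(* Eliminating [nu 8] through the parameter relation leaves an identity of rational functions in
   independent variables. *)
have n8E : nu 8%N = k1 ^+ 2 * k2 ^+ 2 / (r ^+ 2 * (nu 1%N * (nu 2%N * (nu 3%N
    * (nu 4%N * (nu 5%N * (nu 6%N * nu 7%N))))))).
  by rewrite rel; field; rewrite r0 !nu0.
rewrite /acc_P5 /mid_P5 /quartic_quot n8E !mulr0 !add0r.
by field; rewrite k20 z0 r0 k10 f10 !nu0.
Qed.

Lemma heun_const_P5 (K : numFieldType) (q r k1 k2 : K) (nu : nat -> K) :
  r != 0 -> (forall i, (1 <= i <= 8)%N -> nu i != 0) -> r ^+ 2 = q ->
  k1 ^+ 2 * k2 ^+ 2 = q * \prod_(1 <= i < 9) nu i ->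
  (r ^+ 3 * k1 ^+ 2 * k2 / (nu 6%N * nu 7%N * nu 8%N)) ^+ 2 =
  (r * nu 1%N) * (r * k1 / nu 7%N) * (r * k1 / nu 8%N)
    * (r * nu 2%N) * (r * nu 3%N) * (r * nu 4%N) * (q * nu 5%N / nu 6%N).
Proof.
move=> r0 nu0 <-; rewrite unlock /= !mulr1 => rel.
(* A single factor [k1 ^+ 2 * k2 ^+ 2] is isolated, for which the relation is then substituted. *)
transitivity ((r ^+ 3) ^+ 2 * k1 ^+ 2 * (k1 ^+ 2 * k2 ^+ 2)
    / (nu 6%N * nu 7%N * nu 8%N) ^+ 2); first by field; rewrite !nu0.
by rewrite rel; field; rewrite ?r0 !nu0.
Qed.

Definition acc_P7 (K : numFieldType) (r k1 k2 : K) (nu : nat -> K) (f1 : K) : K :=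
  r *
    ( (f1 + k1 ^+ 2 / nu 7%N ^+ 2) * (nu 7%N / nu 8%N - 1)
    + k1 / nu 7%N * (nu 1%N + nu 2%N + nu 3%N + nu 4%N)
    + k1 / nu 8%N * (k2 / nu 5%N + k2 / nu 6%N) ).

(** The only pole left at [g1 = 0] is [z = k1 / nu 7], coming from [f - z]; the summand with
    [f - z / q] carries a factor [g] and vanishes there. *)
Lemma heun_mid_P7 (K : numFieldType) (q r k1 k2 f1 z : K) (nu : nat -> K) :
  r != 0 -> z != 0 -> k1 != 0 -> k2 != 0 -> z != k1 / nu 7%N ->
  z / q != k1 / nu 7%N ->
  (forall i, (1 <= i <= 8)%N -> nu i != 0) -> r ^+ 2 = q ->
  k1 ^+ 2 * k2 ^+ 2 = q * \prod_(1 <= i < 9) nu i ->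
  let T := r * k1 ^+ 2 * k2 / (nu 6%N * nu 7%N * nu 8%N) in
  - (r + r^-1) * z ^+ 3
  + (r * nu 2%N + r * nu 3%N + r * nu 4%N + r * nu 1%N + k1 / (r * nu 7%N)
     + r * k1 / nu 8%N) * z ^+ 2
  - acc_P7 r k1 k2 nu f1 * z + (T + T / (nu 5%N / nu 6%N))
  = - (r * q) * (z - k1 / nu 7%N) * mid_P7 q k1 k2 nu f1 z 0.
Proof.
move=> r0 z0 k10 k20 z7 zq7 nu0 qE; rewrite -{}qE in zq7 *.
rewrite unlock /= !mulr1 => rel.
have n8E : nu 8%N = k1 ^+ 2 * k2 ^+ 2 / (r ^+ 2 * (nu 1%N * (nu 2%N * (nu 3%N
    * (nu 4%N * (nu 5%N * (nu 6%N * nu 7%N))))))).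
  by rewrite rel; field; rewrite r0 !nu0.
rewrite /acc_P7 /mid_P7 n8E !mulr0 !add0r.
field.
rewrite r0 k10 k20 !nu0 //=; apply/andP; split.
- have -> : k1 * r ^+ 2 + - z * nu 7%N = (k1 / nu 7%N - z / r ^+ 2) * (r ^+ 2 * nu 7%N).
    by field; rewrite r0 nu0.
  by rewrite !mulf_neq0 ?expf_neq0 ?nu0 // subr_eq0 eq_sym.
- have -> : k1 + - z * nu 7%N = (k1 / nu 7%N - z) * nu 7%N.
    by field; rewrite nu0.
  by rewrite mulf_neq0 ?nu0 // subr_eq0 eq_sym.
Qed.

Lemma heun_const_P7 (K : numFieldType) (q r k1 k2 : K) (nu : nat -> K) :
  r != 0 -> (forall i, (1 <= i <= 8)%N -> nu i != 0) -> r ^+ 2 = q ->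
  k1 ^+ 2 * k2 ^+ 2 = q * \prod_(1 <= i < 9) nu i ->
  (r * k1 ^+ 2 * k2 / (nu 6%N * nu 7%N * nu 8%N)) ^+ 2 =
  (r * nu 1%N) * (k1 / (r * nu 7%N)) * (r * k1 / nu 8%N)
    * (r * nu 2%N) * (r * nu 3%N) * (r * nu 4%N) * (nu 5%N / nu 6%N).
Proof.
move=> r0 nu0 <-; rewrite unlock /= !mulr1 => rel.
transitivity (r ^+ 2 * k1 ^+ 2 * (k1 ^+ 2 * k2 ^+ 2)
    / (nu 6%N * nu 7%N * nu 8%N) ^+ 2); first by field; rewrite !nu0.
by rewrite rel; field; rewrite ?r0 !nu0.
Qed.

Definition acc_P1 (K : numFieldType) (r k1 k2 : K) (nu : nat -> K) (f1 : K) : K :=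
  r ^+ 3 *
    ( nu 1%N * (nu 2%N - nu 1%N) * (nu 3%N - nu 1%N) * (nu 4%N - nu 1%N)
        / (f1 + nu 1%N ^+ 2)
    + nu 1%N * (k1 / nu 7%N + k1 / nu 8%N)
    + nu 2%N * nu 3%N * nu 4%N
        * (- (nu 1%N)^-1 + (nu 2%N)^-1 + (nu 3%N)^-1 + (nu 4%N)^-1
           + nu 5%N / k2 + nu 6%N / k2) ).

(** At [g1 = 0] the factor [g^-1 - z] equals [nu 1 - z] and cancels [f - z], so only the pole at
    [z = q * nu 1] is left to clear. The parameter [f1] enters through the limit of [rho], hence the
    denominator in [acc_P1]. *)
Lemma heun_mid_P1 (K : numFieldType) (q r k1 k2 f1 z : K) (nu : nat -> K) :
  r != 0 -> z != 0 -> k1 != 0 -> k2 != 0 -> f1 + nu 1%N ^+ 2 != 0 ->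
  z != nu 1%N -> z / q != nu 1%N ->
  (forall i, (1 <= i <= 8)%N -> nu i != 0) -> r ^+ 2 = q ->
  k1 ^+ 2 * k2 ^+ 2 = q * \prod_(1 <= i < 9) nu i ->
  let T := r ^+ 3 * k1 ^+ 2 * k2 / (nu 6%N * nu 7%N * nu 8%N) in
  - (r + r^-1) * z ^+ 3
  + (r * nu 2%N + r * nu 3%N + r * nu 4%N + r ^+ 3 * nu 1%N + r * k1 / nu 7%N
     + r * k1 / nu 8%N) * z ^+ 2
  - acc_P1 r k1 k2 nu f1 * z + (T + T / (nu 5%N / nu 6%N))
  = - (r * q) * (z - q * nu 1%N) * mid_P1 q k1 k2 nu f1 z 0.
Proof.
move=> r0 z0 k10 k20 f10 z1 zq1 nu0 qE; rewrite -{}qE in zq1 *.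
rewrite unlock /= !mulr1 => rel.
have n8E : nu 8%N = k1 ^+ 2 * k2 ^+ 2 / (r ^+ 2 * (nu 1%N * (nu 2%N * (nu 3%N
    * (nu 4%N * (nu 5%N * (nu 6%N * nu 7%N))))))).
  by rewrite rel; field; rewrite r0 !nu0.
rewrite /acc_P1 /mid_P1 /quartic_quot n8E !mulr0 !add0r.
field.
rewrite r0 k10 k20 !nu0 //= -expr2 f10 andbT.
have -> : nu 1%N * r ^+ 2 - z = (nu 1%N - z / r ^+ 2) * r ^+ 2 by field.
by rewrite mulf_neq0 ?expf_neq0 // subr_eq0 eq_sym ?z1.
Qed.

Lemma heun_const_P1 (K : numFieldType) (q r k1 k2 : K) (nu : nat -> K) :
  r != 0 -> (forall i, (1 <= i <= 8)%N -> nu i != 0) -> r ^+ 2 = q ->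
  k1 ^+ 2 * k2 ^+ 2 = q * \prod_(1 <= i < 9) nu i ->
  (r ^+ 3 * k1 ^+ 2 * k2 / (nu 6%N * nu 7%N * nu 8%N)) ^+ 2 =
  (r ^+ 3 * nu 1%N) * (r * k1 / nu 7%N) * (r * k1 / nu 8%N)
    * (r * nu 2%N) * (r * nu 3%N) * (r * nu 4%N) * (nu 5%N / nu 6%N).
Proof.
move=> r0 nu0 <-; rewrite unlock /= !mulr1 => rel.
transitivity ((r ^+ 3) ^+ 2 * k1 ^+ 2 * (k1 ^+ 2 * k2 ^+ 2)
    / (nu 6%N * nu 7%N * nu 8%N) ^+ 2); first by field; rewrite !nu0.
by rewrite rel; field; rewrite ?r0 !nu0.
Qed.

(** * From the restricted equation to the q-Heun equation *)

Lemma qHeun3_P5 (K : numFieldType) (q r k1 k2 f1 z : K) (nu : nat -> K)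
    (p y : K -> K) :
  r != 0 -> k1 != 0 -> k2 != 0 ->
  (forall i, (1 <= i <= 8)%N -> nu i != 0) -> r ^+ 2 = q ->
  k1 ^+ 2 * k2 ^+ 2 = q * \prod_(1 <= i < 9) nu i ->
  z != 0 -> f1 != 0 ->
  p (q * z) = r / nu 1%N * p z -> p (z / q) = (r / nu 1%N)^-1 * p z ->
  L1_down q nu (f1 * 0) 0 z * y (z / q) + mid_P5 q k1 k2 nu f1 z 0 * y z
    + L1_up q k1 nu (f1 * 0) 0 z * y (q * z) = 0 ->
  let T := r ^+ 3 * k1 ^+ 2 * k2 / (nu 6%N * nu 7%N * nu 8%N) in
  qHeun3 q r (r * nu 2%N) (r * nu 3%N) (r * nu 4%N)
    (r * nu 1%N) (r * k1 / nu 7%N) (r * k1 / nu 8%N)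
    (acc_P5 q r k1 k2 nu f1) (T + T / (q * nu 5%N / nu 6%N))
    (fun x => p x * qpoch q (x / nu 1%N) * y x) z.
Proof.
move=> r0 k10 k20 nu0 qE rel z0 f10 pq1 pq2 H T.
have q0 : q != 0 by rewrite -qE expf_neq0.
apply: (qHeun3_gauge q0 pq1 pq2); first exact: (heun_mid_P5 (q := q)).
(* The multiplier is the factor [- (r * q) * z] of [heun_mid_P5] times the gauge contribution
   [1 - z / nu 1]. *)
rewrite -[RHS](mulr0 (r * q * z * (z - nu 1%N) / nu 1%N))
  -[X in _ = _ * X]H.
rewrite /L1_down /L1_up !mulr0 ?add0r.
by rewrite -qE; field; rewrite z0 r0 !nu0.
Qed.

Lemma qHeun3_P7 (K : numFieldType) (q r k1 k2 f1 z : K) (nu : nat -> K)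
    (p y : K -> K) :
  r != 0 -> k1 != 0 -> k2 != 0 ->
  (forall i, (1 <= i <= 8)%N -> nu i != 0) -> r ^+ 2 = q ->
  k1 ^+ 2 * k2 ^+ 2 = q * \prod_(1 <= i < 9) nu i ->
  z != 0 -> z != k1 / nu 7%N -> z / q != k1 / nu 7%N ->
  q * z != k1 / nu 7%N ->
  p (q * z) = r ^+ 3 / nu 1%N * p z -> p (z / q) = (r ^+ 3 / nu 1%N)^-1 * p z ->
  L1_down q nu (f1 * 0 + k1 / nu 7%N) 0 z * y (z / q)
    + mid_P7 q k1 k2 nu f1 z 0 * y z
    + L1_up q k1 nu (f1 * 0 + k1 / nu 7%N) 0 z * y (q * z) = 0 ->
  let T := r * k1 ^+ 2 * k2 / (nu 6%N * nu 7%N * nu 8%N) in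
  qHeun3 q r (r * nu 2%N) (r * nu 3%N) (r * nu 4%N)
    (r * nu 1%N) (k1 / (r * nu 7%N)) (r * k1 / nu 8%N)
    (acc_P7 r k1 k2 nu f1) (T + T / (nu 5%N / nu 6%N))
    (fun x => p x * qpoch q (x / nu 1%N) * y x / (x - k1 / nu 7%N)) z.
Proof.
move=> r0 k10 k20 nu0 qE rel z0 z7 zq7 qz7 pq1 pq2 H T.
have q0 : q != 0 by rewrite -qE expf_neq0.
have -> : (fun x => p x * qpoch q (x / nu 1%N) * y x / (x - k1 / nu 7%N)) =
    (fun x => p x * qpoch q (x / nu 1%N) * (y x / (x - k1 / nu 7%N))).
  by apply/funext => x; rewrite mulrA.
apply: (qHeun3_gauge q0 pq1 pq2); first exact: (heun_mid_P7 (q := q)).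
(* Compared with $P_5$, no linear factor from the pole remains: the denominator of the gauge factor
   absorbs [z - k1 / nu 7]. *)
rewrite -[RHS](mulr0 (r * q * (z - nu 1%N) / nu 1%N))
  -[X in _ = _ * X]H.
rewrite /L1_down /L1_up !mulr0 ?add0r.
have zn7 : z * nu 7%N - k1 != 0.
  have -> : z * nu 7%N - k1 = (z - k1 / nu 7%N) * nu 7%N.
    by field; rewrite nu0.
  by rewrite mulf_neq0 ?nu0 // subr_eq0.
have wn7 : z * nu 7%N + - k1 * r ^+ 2 != 0.
  have -> : z * nu 7%N + - k1 * r ^+ 2 = (z / q - k1 / nu 7%N) * (q * nu 7%N).
    by rewrite -qE; field; rewrite r0 nu0.
  by rewrite !mulf_neq0 ?nu0 // subr_eq0.
have qzn7 : r ^+ 2 * z * nu 7%N - k1 != 0.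
  have -> : r ^+ 2 * z * nu 7%N - k1 = (q * z - k1 / nu 7%N) * nu 7%N.
    by rewrite -qE; field; rewrite nu0.
  by rewrite mulf_neq0 ?nu0 // subr_eq0.
have zn7' : k1 + - z * nu 7%N != 0 by rewrite mulNr -opprB oppr_eq0.
have wn7' : k1 * r ^+ 2 + - z * nu 7%N != 0.
  by rewrite mulNr -opprB oppr_eq0 -mulNr.
by rewrite -qE; field; rewrite zn7 zn7' wn7 wn7' qzn7 r0 !nu0.
Qed.

Lemma qHeun3_P1 (K : numFieldType) (q r k1 k2 f1 z : K) (nu : nat -> K)
    (p y : K -> K) :
  r != 0 -> k1 != 0 -> k2 != 0 ->
  (forall i, (1 <= i <= 8)%N -> nu i != 0) -> r ^+ 2 = q ->
  k1 ^+ 2 * k2 ^+ 2 = q * \prod_(1 <= i < 9) nu i ->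
  z != 0 -> f1 + nu 1%N ^+ 2 != 0 ->
  z != nu 1%N -> z / q != nu 1%N ->
  p (q * z) = r / nu 1%N * p z -> p (z / q) = (r / nu 1%N)^-1 * p z ->
  L1_down q nu (f1 * 0 + nu 1%N) 0 z * y (z / q) + mid_P1 q k1 k2 nu f1 z 0 * y z
    + L1_up q k1 nu (f1 * 0 + nu 1%N) 0 z * y (q * z) = 0 ->
  let T := r ^+ 3 * k1 ^+ 2 * k2 / (nu 6%N * nu 7%N * nu 8%N) in
  qHeun3 q r (r * nu 2%N) (r * nu 3%N) (r * nu 4%N)
    (r ^+ 3 * nu 1%N) (r * k1 / nu 7%N) (r * k1 / nu 8%N)
    (acc_P1 r k1 k2 nu f1) (T + T / (nu 5%N / nu 6%N))
    (fun x => p x * qpoch q (x / nu 1%N) * y x) z.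
Proof.
move=> r0 k10 k20 nu0 qE rel z0 f10 z1 zq1 pq1 pq2 H T.
have q0 : q != 0 by rewrite -qE expf_neq0.
apply: (qHeun3_gauge q0 pq1 pq2); first exact: (heun_mid_P1 (q := q)).
(* Here [z - nu 1] cancels against [f - z] in the coefficient of [y (q * z)], and [z - q * nu 1]
   takes its place; this is why [l1] is [r ^+ 3 * nu 1]. *)
rewrite -[RHS](mulr0 (r * q * (z - q * nu 1%N) * (z - nu 1%N) / nu 1%N))
  -[X in _ = _ * X]H.
rewrite /L1_down /L1_up !mulr0 ?add0r.
have z1' : nu 1%N - z != 0 by rewrite subr_eq0 eq_sym.
have w1 : nu 1%N * r ^+ 2 - z != 0.
  have -> : nu 1%N * r ^+ 2 - z = (nu 1%N - z / q) * q.
    by rewrite -qE; field.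
  by rewrite mulf_neq0 // subr_eq0 eq_sym.
by rewrite -qE; field; rewrite z1' w1 r0 !nu0.
Qed.

Theorem mainTheorem2 (R : realType) (q r k1 k2 : R[i]) (nu : nat -> R[i])
    (hq : 0 < `|q| < 1) (hr : r ^+ 2 = q) (hk1 : k1 != 0) (hk2 : k2 != 0)
    (hnu : forall i, (1 <= i <= 8)%N -> nu i != 0)
    (hrel : k1 ^+ 2 * k2 ^+ 2 = q * \prod_(1 <= i < 9) nu i) :
  [/\ (* the points P_5 and P_6 *)
      forall i : nat, i \in [:: 5; 6]%N ->
      let mu := exch 5 i nu in
      let h1 := r * mu 2%N in let h2 := r * mu 3%N in let h3 := r * mu 4%N in
      let h4 := q * mu 5%N / mu 6%N in
      let l1 := r * mu 1%N in
      let l2 := r * k1 / mu 7%N in let l3 := r * k1 / mu 8%N in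
      exists2 w : R[i], qHeun3_const h1 h2 h3 h4 l1 l2 l3 w &
      forall f1 : R[i], f1 != 0 ->
      let E := r ^+ 3 *
        ( mu 1%N * mu 2%N * mu 3%N * mu 4%N * (mu 6%N / mu 5%N - 1)
            * (f1^-1 + mu 5%N ^+ 2 / k2 ^+ 2)
        + mu 1%N * mu 2%N * mu 3%N * mu 4%N * (mu 5%N / k2)
            * ((mu 1%N)^-1 + (mu 2%N)^-1 + (mu 3%N)^-1 + (mu 4%N)^-1)
        + k2 / (q * mu 5%N) * (k1 / mu 7%N + k1 / mu 8%N) ) in
      let D := [set z : R[i] | z != 0] in
      exists a b c : R[i] -> R[i],
        L1_restriction q k1 k2 nu
          (fun g1 => f1 * g1) (fun g1 => g1 + mu 5%N / k2) D a b c /\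
        forall (lam : R[i]) (zlam : R[i] -> R[i]),
        qpower_branch q lam (r / mu 1%N) zlam ->
        forall (y : R[i] -> R[i]) (z : R[i]), D z ->
        a z * y (z / q) + b z * y z + c z * y (q * z) = 0 ->
        qHeun3 q r h1 h2 h3 l1 l2 l3 E w
          (fun x => zlam x * qpoch q (x / mu 1%N) * y x) z,
      (* the points P_7 and P_8 *)
      forall i : nat, i \in [:: 7; 8]%N ->
      let mu := exch 7 i nu in
      let h1 := r * mu 2%N in let h2 := r * mu 3%N in let h3 := r * mu 4%N in
      let h4 := mu 5%N / mu 6%N in
      let l1 := r * mu 1%N in
      let l2 := k1 / (r * mu 7%N) in let l3 := r * k1 / mu 8%N in
      exists2 w : R[i], qHeun3_const h1 h2 h3 h4 l1 l2 l3 w &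
      forall f1 : R[i],
      let E := r *
        ( (f1 + k1 ^+ 2 / mu 7%N ^+ 2) * (mu 7%N / mu 8%N - 1)
        + k1 / mu 7%N * (mu 1%N + mu 2%N + mu 3%N + mu 4%N)
        + k1 / mu 8%N * (k2 / mu 5%N + k2 / mu 6%N) ) in
      let D := [set z : R[i] |
                  [&& z != 0, z != k1 / mu 7%N & z / q != k1 / mu 7%N]] in
      exists a b c : R[i] -> R[i],
        L1_restriction q k1 k2 nu
          (fun g1 => f1 * g1 + k1 / mu 7%N) (fun g1 => g1) D a b c /\
        forall (lam : R[i]) (zlam : R[i] -> R[i]),
        qpower_branch q lam (r ^+ 3 / mu 1%N) zlam ->
        forall (y : R[i] -> R[i]) (z : R[i]), D z -> q * z != k1 / mu 7%N ->
        a z * y (z / q) + b z * y z + c z * y (q * z) = 0 ->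
        qHeun3 q r h1 h2 h3 l1 l2 l3 E w
          (fun x => zlam x * qpoch q (x / mu 1%N) * y x / (x - k1 / mu 7%N)) z
    & (* the points P_1, P_2, P_3 and P_4 *)
      forall i : nat, i \in [:: 1; 2; 3; 4]%N ->
      let mu := exch 1 i nu in
      let h1 := r * mu 2%N in let h2 := r * mu 3%N in let h3 := r * mu 4%N in
      let h4 := mu 5%N / mu 6%N in
      let l1 := r ^+ 3 * mu 1%N in
      let l2 := r * k1 / mu 7%N in let l3 := r * k1 / mu 8%N in
      exists2 w : R[i], qHeun3_const h1 h2 h3 h4 l1 l2 l3 w &
      forall f1 : R[i], f1 + mu 1%N ^+ 2 != 0 ->
      let E := r ^+ 3 *
        ( mu 1%N * (mu 2%N - mu 1%N) * (mu 3%N - mu 1%N) * (mu 4%N - mu 1%N)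
            / (f1 + mu 1%N ^+ 2)
        + mu 1%N * (k1 / mu 7%N + k1 / mu 8%N)
        + mu 2%N * mu 3%N * mu 4%N
            * (- (mu 1%N)^-1 + (mu 2%N)^-1 + (mu 3%N)^-1 + (mu 4%N)^-1
               + mu 5%N / k2 + mu 6%N / k2) ) in
      let D := [set z : R[i] | [&& z != 0, z != mu 1%N & z / q != mu 1%N]] in
      exists a b c : R[i] -> R[i],
        L1_restriction q k1 k2 nu
          (fun g1 => f1 * g1 + mu 1%N) (fun g1 => g1 + (mu 1%N)^-1) D a b c /\
        forall (lam : R[i]) (zlam : R[i] -> R[i]),
        qpower_branch q lam (r / mu 1%N) zlam ->
        forall (y : R[i] -> R[i]) (z : R[i]), D z ->
        a z * y (z / q) + b z * y z + c z * y (q * z) = 0 ->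
        qHeun3 q r h1 h2 h3 l1 l2 l3 E w
          (fun x => zlam x * qpoch q (x / mu 1%N) * y x) z ].
Proof.
have q0 : q != 0 by move: hq; case/andP; rewrite normr_gt0.
have r0 : r != 0 by apply: contra q0 => /eqP r0; rewrite -hr r0 expr0n.
(* The exchanged parameters satisfy the same hypotheses and define the same restriction, so each
   family of points reduces to its first member. *)
have exchP B i j : B \in blocks -> i \in B -> j \in B ->
    [/\ forall k, (1 <= k <= 8)%N -> exch i j nu k != 0,
        k1 ^+ 2 * k2 ^+ 2 = q * \prod_(1 <= k < 9) exch i j nu k
      & L1_restriction q k1 k2 nu = L1_restriction q k1 k2 (exch i j nu)].
  move=> bB iB jB.
  have inB k : k \in B -> (1 <= k <= 8)%N.
    move: bB; rewrite !inE => /or3P[]/eqP->; rewrite !inE.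
    - by case/or4P => /eqP->.
    - by case/orP => /eqP->.
    - by case/orP => /eqP->.
  split; first by apply: exch_neq0 => //; exact: inB.
    by rewrite (prod_exch _ bB).
  by rewrite (L1_restriction_exch _ _ _ _ bB).
split=> i iB mu.
- have [] := exchP [:: 5; 6]%N 5%N i erefl erefl iB.
  rewrite -/mu; move: mu => mu mu0 relmu -> h1 h2 h3 h4 l1 l2 l3.
  (* The constant term involves neither [f1] nor [z], so one choice of sign serves the whole
     exceptional line. *)
  exists (let T := r ^+ 3 * k1 ^+ 2 * k2 / (mu 6%N * mu 7%N * mu 8%N) in T + T / h4).
    apply: qHeun3_const_of_sqr; first by rewrite /h4 !mulf_neq0 ?invr_eq0 ?mu0.
    exact: (heun_const_P5 (q := q)).
  move=> f1 f10 E D.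
  exists (L1_down q mu (f1 * 0) 0), (fun z => mid_P5 q k1 k2 mu f1 z 0),
    (L1_up q k1 mu (f1 * 0) 0).
  split; first exact: restriction_P5.
  move=> lam p [_ _ pq] y z z0 H; have [pq1 pq2] := pq z z0.
  exact: (qHeun3_P5 (q := q) (k1 := k1) (k2 := k2) (f1 := f1)).
- have [] := exchP [:: 7; 8]%N 7%N i erefl erefl iB.
  rewrite -/mu; move: mu => mu mu0 relmu -> h1 h2 h3 h4 l1 l2 l3.
  exists (let T := r * k1 ^+ 2 * k2 / (mu 6%N * mu 7%N * mu 8%N) in T + T / h4).
    apply: qHeun3_const_of_sqr; first by rewrite /h4 !mulf_neq0 ?invr_eq0 ?mu0.
    exact: (heun_const_P7 (q := q)).
  move=> f1 E D.
  exists (L1_down q mu (f1 * 0 + k1 / mu 7%N) 0), (fun z => mid_P7 q k1 k2 mu f1 z 0),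
    (L1_up q k1 mu (f1 * 0 + k1 / mu 7%N) 0).
  split; first exact: restriction_P7.
  move=> lam p [_ _ pq] y z /and3P[z0 z7 zq7] qz7 H.
  have [pq1 pq2] := pq z z0.
  exact: (qHeun3_P7 (q := q) (k1 := k1) (k2 := k2) (f1 := f1)).
- have [] := exchP [:: 1; 2; 3; 4]%N 1%N i erefl erefl iB.
  rewrite -/mu; move: mu => mu mu0 relmu -> h1 h2 h3 h4 l1 l2 l3.
  exists (let T := r ^+ 3 * k1 ^+ 2 * k2 / (mu 6%N * mu 7%N * mu 8%N) in T + T / h4).
    apply: qHeun3_const_of_sqr; first by rewrite /h4 !mulf_neq0 ?invr_eq0 ?mu0.
    exact: (heun_const_P1 (q := q)).
  move=> f1 f10 E D.
  exists (L1_down q mu (f1 * 0 + mu 1%N) 0), (fun z => mid_P1 q k1 k2 mu f1 z 0),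
    (L1_up q k1 mu (f1 * 0 + mu 1%N) 0).
  split; first exact: restriction_P1.
  move=> lam p [_ _ pq] y z /and3P[z0 z1 zq1] H.
  have [pq1 pq2] := pq z z0.
  exact: (qHeun3_P1 (q := q) (k1 := k1) (k2 := k2) (f1 := f1)).
Qed.
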